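(* Let $G = D_n = \langle a, b \mid a^n = b^2 = 1,\ bab = a^{-1} \rangle$ be the dihedral group of order $2n$. Let $H$ be a connecting set for the graph $\mathrm{Cay}(G,H)$, let $A$ be the adjacency matrix of $\mathrm{Cay}(G,H)$, and let $M$ and $N$ be the $n \times n$ blocks of $A$ defined in the context. Then the eigenvalues of $A$ (counted with multiplicity) are those of $M+N$ together with those of $M-N$.
   Context: For a finite group $G$, a subset $H \subseteq G$ is called a connecting set if (i) $H^{-1} = \{h^{-1} : h \in H\} = H$, (ii) $1_G \notin H$, and (iii) $H$ generates $G$. The Cayley graph $\mathrm{Cay}(G,H)$ is the graph with vertex set $G$ in which $u, v \in G$ are adjacent if and only if $vu^{-1} \in H$. For $G = D_n$ let $C_n = \langle a \rangle$ and order the vertices as $1, a, \dots, a^{n-1}, b, ab, \dots, a^{n-1}b$. With respect to the partition $G = C_n \cup C_n b$ the adjacency matrix has the block form $A = \begin{pmatrix} M & N \\ N^t & M \end{pmatrix}$, where $M$ is the $n \times n$ block with rows and columns indexed by $C_n$, $N$ is the $n \times n$ block with rows indexed by $C_n$ and columns indexed by $C_n b$, and $N^t$ is the transpose of $N$. *)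

(* Defs.v *)
From HB Require Import structures.
From mathcomp Require Import all_boot all_order all_fingroup all_algebra.
From mathcomp Require Import all_solvable.

Set Implicit Arguments.
Unset Strict Implicit.
Unset Printing Implicit Defensive.

Import GroupScope GRing.Theory.

(* G = < a, b | a^n = b^2 = 1, b a b = a^-1 >, of order 2n.  The relations
   make G a quotient of the presented group, and the order makes it equal to
   that group: see dihedral_Grp below.  Unlike the library's 'D_(n.*2), this
   covers n = 1 and fixes the generators a and b. *)
Definition dihedral_gen (gT : finGroupType) (n : nat) (G : {group gT})
    (a b : gT) : Prop :=
  [/\ G :=: <<[set a; b]>>, a ^+ n = 1, b ^+ 2 = 1, b * a * b = a^-1
    & #|G| = n.*2].

Definition connecting_set (gT : finGroupType) (G : {group gT})
    (H : {set gT}) : Prop :=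
  [/\ H \subset G, H^-1 = H, 1 \notin H & <<H>> = G].

Definition cayley_adj (gT : finGroupType) (H : {set gT}) : rel gT :=
  fun u v => v * u^-1 \in H.

(* The vertices in the order 1, a, ..., a^(n-1), b, ab, ..., a^(n-1)b. *)
Definition dihedral_vertex (gT : finGroupType) (n : nat) (a b : gT)
    (i : 'I_(n + n)) : gT :=
  match split i with
  | inl k => a ^+ k
  | inr k => a ^+ k * b
  end.

Definition adjacency_mx (C : nzRingType) (T : Type) (m : nat) (e : rel T)
    (v : 'I_m -> T) : 'M[C]_m :=
  (\matrix_(i, j) (e (v i) (v j))%:R)%R.

(* Eigenvalues listed with algebraic multiplicity, in an unspecified order:
   to be compared only up to perm_eq. *)
Definition eigenvalues (C : closedFieldType) (m : nat) (A : 'M[C]_m) :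
    seq C :=
  sval (closed_field_poly_normal (char_poly A)).

Lemma eigenvaluesE (C : closedFieldType) (m : nat) (A : 'M[C]_m) :
  (char_poly A = \prod_(z <- eigenvalues A) ('X - z%:P))%R.
Proof.
rewrite /eigenvalues; case: closed_field_poly_normal => r /= {1}->.
by rewrite (monicP (char_poly_monic A)) scale1r.
Qed.

Lemma dihedral_Grp (gT : finGroupType) (n : nat) (G : {group gT}) (a b : gT) :
  dihedral_gen n G a b ->
  G \isog Grp (x : y : x ^+ n, y ^+ 2, y * x * y = x^-1).
Proof.
case=> defG an1 b21 bab oG.
have homG: G \homg Grp (x : y : x ^+ n, y ^+ 2, y * x * y = x^-1).
  apply/existsP; exists (a, b); rewrite /= !xpair_eqE an1 b21 bab !eqxx !andbT.
  by rewrite defG /= joing_idl joing_idr.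
apply: intro_isoGrp => // rT H.
case/existsP=> -[x y] /=; rewrite !xpair_eqE /=.
case/and4P=> /eqP defH /eqP xn1 /eqP y21 /eqP yxy.
have [n_gt1 | n_le1] := ltnP 1 n.
  have conv (hT : finGroupType) (u v : hT) :
      v ^+ 2 = 1 -> v * u * v = u^-1 -> u ^ v = u^-1.
    move=> v21 <-; rewrite conjgE mulgA; congr (_ * _ * _).
    by apply/eqP; rewrite eq_invg_mul -expg2 v21.
  have presD := Grp_dihedral n_gt1.
  have isoG: G \isog 'D_(n.*2).
    apply/(isoGrpP _ presD); split; first by rewrite oG card_dihedral.
    apply/existsP; exists (a, b); rewrite /= !xpair_eqE an1 b21 conv // !eqxx.
    by rewrite !andbT defG /= joing_idl joing_idr.
  rewrite (eq_homgr H isoG) presD.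
  apply/existsP; exists (x, y); rewrite /= !xpair_eqE xn1 y21 conv // !eqxx.
  by rewrite !andbT defH.
have n1: n = 1%N by have := cardG_gt0 G; rewrite oG; case: (n) n_le1 => [|[]].
have x1: x = 1 by rewrite -xn1 n1.
have a1: a = 1 by rewrite -an1 n1.
have Gb: G :=: <[b]>.
  have: G :=: <[a]> <*> <[b]> by rewrite joing_idl joing_idr.
  by rewrite a1 cycle1 joing1G.
have Hy: H :=: <[y]> by rewrite -defH x1 cycle1 joing1G.
have ob: #[b] = 2 by rewrite orderE -Gb oG n1.
have dvd: #[y] %| #[b] by rewrite ob order_dvdn y21.
rewrite Hy Gb; apply/homgP; exists (eltm_morphism dvd); exact: im_eltm.
Qed.

(* Main.v *)
Require Import Defs.
From HB Require Import structures.
From mathcomp Require Import all_boot all_order all_fingroup all_algebra.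

Set Implicit Arguments.
Unset Strict Implicit.
Unset Printing Implicit Defensive.

Import GroupScope GRing.Theory.

(** Because [b] is an involution, the two off-diagonal blocks of [A] coincide, as do the two
    diagonal ones ([adjacency_dihedral_block]). A matrix of this shape is similar to a block
    triangular one with diagonal blocks [M + N] and [M - N], so its characteristic polynomial
    factors accordingly, and the roots are the two spectra together. *)

Lemma det_block_mx_sym (R : comNzRingType) (n : nat) (P Q : 'M[R]_n) :
  (\det (block_mx P Q Q P) = \det (P + Q) * \det (P - Q))%R.
Proof.
(* The outer factors are mutually inverse and unipotent, so no division by 2 occurs. *)
have eqB : (block_mx 1%:M 0 (- 1%:M) 1%:M *m block_mx P Q Q P
    *m block_mx 1%:M 0 1%:M 1%:M = block_mx (P + Q) Q 0 (P - Q))%R.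
  rewrite !mulmx_block !mul1mx !mulmx1 !mul0mx !mulmx0 !mulNmx !mul1mx.
  by rewrite !addr0 !add0r !(addrC (- _)%R) addrA subrK subrr.
have := congr1 determinant eqB.
by rewrite !det_mulmx !det_lblock det_ublock !det1 !mul1r !mulr1.
Qed.

(** The characteristic matrix keeps the symmetric shape, with [P = 'X - M] and [Q = - N]. *)
Lemma char_poly_block_mx_sym (R : comNzRingType) (n : nat) (M N : 'M[R]_n) :
  (char_poly (block_mx M N N M) = char_poly (M + N) * char_poly (M - N))%R.
Proof.
rewrite /char_poly /char_poly_mx map_block_mx scalar_mx_block.
rewrite opp_block_mx add_block_mx !add0r det_block_mx_sym.
by rewrite map_mxD map_mxB opprD opprB opprK addrA (addrC (map_mx _ N)) addrA.
Qed.

(** A product of monic linear factors determines its roots up to order. *)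
Lemma perm_eigenvalues_cat (C : closedFieldType) (m p q : nat)
    (A : 'M[C]_m) (B : 'M[C]_p) (D : 'M[C]_q) :
  (char_poly A = char_poly B * char_poly D)%R ->
  perm_eq (eigenvalues A) (eigenvalues B ++ eigenvalues D).
Proof.
by rewrite !eigenvaluesE -big_cat; apply: prod_XsubC_eq.
Qed.

(* The lower left block comes out as N itself rather than N^T: as b is an
   involution, a^j (a^i b)^-1 = a^j b a^-i, which is also the connecting element
   of the upper right block. *)
Lemma adjacency_dihedral_block (C : nzRingType) (n : nat)
    (gT : finGroupType) (a b : gT) (H : {set gT}) (b2 : b ^+ 2 = 1) :
  let A : 'M[C]_(n + n) :=
    adjacency_mx C (cayley_adj H) (@dihedral_vertex gT n a b) in
  A = block_mx (ulsubmx A) (ursubmx A) (ursubmx A) (ulsubmx A).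
Proof.
move=> A; rewrite -[LHS]submxK.
have bV : b^-1 = b by apply/eqP; rewrite eq_invg_mul -expg2 b2.
have vl i : dihedral_vertex a b (lshift n i) = a ^+ i.
  by rewrite /dihedral_vertex (unsplitK (inl i)).
have vr i : dihedral_vertex a b (rshift n i) = a ^+ i * b.
  by rewrite /dihedral_vertex (unsplitK (inr i)).
congr block_mx; apply/matrixP => i j;
  rewrite !mxE !vl !vr /cayley_adj invMg bV !mulgA //.
(* Only the lower right block remains: [b * b] cancels in [a^j b (a^i b)^-1]. *)
by rewrite -(mulgA _ b b) -expg2 b2 mulg1.
Qed.

Theorem theorem3p1 (C : numClosedFieldType) (n : nat) (n_gt0 : (0 < n)%N)
    (gT : finGroupType) (G : {group gT}) (a b : gT)
    (G_dihedral : dihedral_gen n G a b)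
    (H : {set gT}) (H_connecting : connecting_set G H) :
  let A : 'M[C]_(n + n) :=
    adjacency_mx C (cayley_adj H) (@dihedral_vertex gT n a b) in
  let M : 'M[C]_n := ulsubmx A in
  let N : 'M[C]_n := ursubmx A in
  is_true (perm_eq (eigenvalues A)
    (eigenvalues (M + N)%R ++ eigenvalues (M - N)%R)).
Proof.
case: G_dihedral => _ _ b2 _ _ A M N.
apply: perm_eigenvalues_cat.
by rewrite -char_poly_block_mx_sym -adjacency_dihedral_block.
Qed.
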